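(* Consider the Multigrid Algorithm described in the context, with $n$ levels $X_{h_1}\subset\cdots\subset X_{h_n}$ and $N_k=\dim X_{h_k}$. Assume that the work of solving the Gross–Pitaevskii eigenvalue problem in the initial finite element space $X_{h_1}$ is $\mathcal{O}(M_{h_1})$ and that the work of solving the linear boundary value problem in each level $X_{h_k}$ is $\mathcal{O}(N_k)$ for $k=1,2,\dots,n$ (with constants uniform in $k$ and $n$). Then the total work of the multigrid method is $\mathcal{O}(N_n+M_{h_1})$. Furthermore, if $M_{h_1}\le N_n$, the total work is $\mathcal{O}(N_n)$.
   Context: $\Omega\subset\mathbb{R}^d$ ($d=1,2,3$) is a bounded domain, $V=H_0^1(\Omega)$. $V_{h_1}\subset V_{h_2}\subset\cdots\subset V_{h_n}\subset V$ are linear finite element spaces on meshes $\mathcal{T}_{h_1},\dots,\mathcal{T}_{h_n}$ of $\Omega$, each mesh obtained from the previous one by regular refinement in which every cell is split into $\beta^d$ congruent cells, where $\beta\ge2$ is an integer. $X_{h_k}=\mathbb{R}\times V_{h_k}$ and $N_k=\dim X_{h_k}$; the dimensions satisfy $N_k\approx\beta^{d(k-n)}N_n$ for $k=1,\dots,n$, where $x\approx y$ means $c\,x\le y\le C'x$ with constants $c,C'>0$ independent of mesh sizes (and of $k,n$). Gross–Pitaevskii eigenvalue problem on $X_{h_1}$: find the smallest eigenpair $(\lambda^{h_1},u^{h_1})\in X_{h_1}$ with $\int_\Omega(u^{h_1})^2\,d\Omega=1$ and $\int_\Omega(\nabla u^{h_1}\cdot\nabla v+Wu^{h_1}v+\zeta(u^{h_1})^3v)\,d\Omega=\lambda^{h_1}\int_\Omega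 u^{h_1}v\,d\Omega$ for all $v\in V_{h_1}$, where $\zeta>0$ and $W(x)=\gamma_1x_1^2+\cdots+\gamma_dx_d^2$ with all $\gamma_i>0$. Multigrid Algorithm: first solve the Gross–Pitaevskii eigenvalue problem on $X_{h_1}$; then for $k=1,\dots,n-1$ compute $(\lambda^{h_{k+1}},u^{h_{k+1}})\in X_{h_{k+1}}$ by (approximately) solving once the linear problem in $X_{h_{k+1}}$: find $(\hat\lambda,\hat u)\in X_{h_{k+1}}$ such that for all $(\mu,v)\in X_{h_{k+1}}$ $$\begin{cases}\int_\Omega\big(\nabla\hat u\cdot\nabla v+W\hat uv+3\zeta(u^{h_k})^2\hat uv-\lambda^{h_k}\hat uv\big)d\Omega-\hat\lambda\int_\Omega u^{h_k}v\,d\Omega=\int_\Omega(2\zeta(u^{h_k})^3-\lambda^{h_k}u^{h_k})v\,d\Omega,\\-\mu\int_\Omega\hat u\,u^{h_k}\,d\Omega=-\mu/2-\frac{\mu}{2}\int_\Omega(u^{h_k})^2\,d\Omega.\end{cases}$$ The total work is the sum over levels $k=1,\dots,n$ of the work $W_k$ spent in $X_{h_k}$: $W_1$ is the work of solving the eigenvalue problem in $X_{h_1}$, and for $k\ge2$, $W_k$ is the work of the linear boundary value problem in $X_{h_k}$. *)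

(* Defs.v *)
From HB Require Import structures.
From mathcomp Require Import all_boot all_order all_algebra.
From mathcomp Require Import all_classical all_reals all_analysis.
Set Implicit Arguments.
Unset Strict Implicit.
Unset Printing Implicit Defensive.
Import Order.TTheory GRing.Theory Num.Theory.
Import numFieldNormedType.Exports.
Local Open Scope classical_set_scope.
Local Open Scope ring_scope.

(* Functions on a domain Omega of R^d that belong to H^1_0(Omega) are
   represented by their extension by zero, of type 'rV[R]_d -> R^o. *)

Definition bounded_domain (R : realType) (d : nat) (Om : set 'rV[R]_d) : Prop :=
  [/\ open Om, connected Om, bounded_set Om & Om !=set0].

(* Lebesgue integration on R^d, as the iterated one-dimensional integral; it
   agrees with the d-dimensional integral (Tonelli, Fubini) on the functions it
   is used for, which are measurable, and nonnegative or integrable on every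
   line parallel to an axis. *)
Fixpoint iter_integral (R : realType) (d : nat) :
    ('rV[R]_d -> \bar R) -> \bar R :=
  match d with
  | 0 => fun f => f 0
  | d'.+1 => fun f =>
      (\int[@lebesgue_measure R]_(t in [set: R])
         iter_integral (fun y : 'rV[R]_d' =>
           f (row_mx (t%:M : 'rV[R]_1) y : 'rV[R]_(1 + d'))))%E
  end.

Definition integral_on (R : realType) (d : nat) (Om : set 'rV[R]_d)
    (f : 'rV[R]_d -> R^o) : R :=
  fine (iter_integral (fun x => (f x * \1_Om x)%:E)).

Definition partial (R : realType) (d : nat) (i : 'I_d) (f : 'rV[R]_d -> R^o) :
    'rV[R]_d -> R^o :=
  fun x => 'D_(delta_mx 0 i) f x.

(* On continuous piecewise affine functions, where it is used, this classical
   gradient is the weak gradient almost everywhere. *)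
Definition grad_dot (R : realType) (d : nat) (f g : 'rV[R]_d -> R^o) :
    'rV[R]_d -> R^o :=
  fun x => \sum_(i < d) partial i f x * partial i g x.

Definition smooth (R : realType) (d : nat) (f : 'rV[R]_d -> R^o) : Prop :=
  forall s : seq 'I_d,
    let g := foldr (@partial R d) f s in
    continuous g /\ forall i x, derivable g x (delta_mx 0 i).

Definition test_function (R : realType) (d : nat) (Om : set 'rV[R]_d)
    (f : 'rV[R]_d -> R^o) : Prop :=
  smooth f /\
  exists K : set 'rV[R]_d,
    [/\ compact K, K `<=` Om & forall x, ~ K x -> f x = 0].

Definition L2sq (R : realType) (d : nat) (f : 'rV[R]_d -> R^o) : \bar R :=
  iter_integral (fun x => (f x ^+ 2)%:E).

(* H^1_0(Omega), the completion of C_c^infty(Omega) for the H^1 norm. *)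
Definition H10 (R : realType) (d : nat) (Om : set 'rV[R]_d) :
    set ('rV[R]_d -> R^o) :=
  [set u | measurable_fun [set: d.-tuple R]
             (fun t : d.-tuple R => (u (\row_i tnth t i) : R)) /\
    exists phi : nat -> 'rV[R]_d -> R^o,
      [/\ forall j, test_function Om (phi j),
          L2sq (phi j \- u) @[j --> \oo] --> (0 : \bar R) &
          forall e : R, 0 < e -> exists J : nat, forall j l i,
            (J <= j)%N -> (J <= l)%N ->
            (L2sq (partial i (phi j) \- partial i (phi l))%R < e%:E)%E]].

(* A d-simplex, given by the matrix whose rows are its d + 1 vertices. *)
Definition simplex (R : realType) (d : nat) := 'M[R]_(d.+1, d).

Definition nondegenerate (R : realType) (d : nat) (K : simplex R d) : Prop :=
  row_free (row_mx K (const_mx 1 : 'cV[R]_d.+1)).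

Definition barycentric (R : realType) (d : nat) (w : 'rV[R]_d.+1) : Prop :=
  (forall i, 0 <= w 0 i) /\ \sum_i w 0 i = 1.

Definition hull (R : realType) (d : nat) (K : simplex R d) : set 'rV[R]_d :=
  [set w *m K | w in @barycentric R d].

(* The convex hull of the vertices that K shares with L. *)
Definition common_face (R : realType) (d : nat) (K L : simplex R d) :
    set 'rV[R]_d :=
  [set w *m K | w in [set w | barycentric w /\
     forall i, w 0 i != 0 -> exists j, row i K = row j L]].

(* Conforming simplicial triangulations of Omega. *)
Definition is_mesh (R : realType) (d : nat) (Om : set 'rV[R]_d)
    (T : seq (simplex R d)) : Prop :=
  [/\ uniq T,
      {in T, forall K, nondegenerate K},
      closure Om = \bigcup_(K in [set` T]) hull K,
      {in T &, injective (@hull R d)} &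
      {in T &, forall K L, K != L -> hull K `&` hull L = common_face K L}].

Definition congruent (R : realType) (d : nat) (A B : set 'rV[R]_d) : Prop :=
  exists (Q : 'M[R]_d) (b : 'rV[R]_d),
    Q *m Q^T = 1%:M /\ B = [set x *m Q + b | x in A].

Definition regular_refinement (R : realType) (d beta : nat)
    (T T' : seq (simplex R d)) : Prop :=
  {in T, forall K,
    let S := [seq L <- T' | `[< hull L `<=` hull K >]] in
    [/\ size S = (beta ^ d)%N,
        hull K = \bigcup_(L in [set` S]) hull L &
        {in S &, forall L L', congruent (hull L) (hull L')}]}.

Definition affine_on (R : realType) (d : nat) (A : set 'rV[R]_d)
    (v : 'rV[R]_d -> R^o) : Prop :=
  exists (a : 'cV[R]_d) (b : R), forall x, A x -> v x = (x *m a) 0 0 + b.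

(* The linear finite element space V_h on the mesh T. *)
Definition fe_space (R : realType) (d : nat) (Om : set 'rV[R]_d)
    (T : seq (simplex R d)) : set ('rV[R]_d -> R^o) :=
  [set v | [/\ H10 Om v, continuous v &
               {in T, forall K, affine_on (hull K) v}]].

(* X_h = R x V_h. *)
Definition fe_pair_space (R : realType) (d : nat) (Om : set 'rV[R]_d)
    (T : seq (simplex R d)) : set (R^o * ('rV[R]_d -> R^o)) :=
  [set p | fe_space Om T p.2].

Definition is_basis (R : realType) (U : lmodType R) (S : set U) (n : nat)
    (b : 'I_n -> U) : Prop :=
  [/\ forall i, S (b i),
      forall a : 'I_n -> R, \sum_i a i *: b i = 0 -> forall i, a i = 0 &
      forall x, S x -> exists a : 'I_n -> R, x = \sum_i a i *: b i].

(* For a subspace S; 0 if S is not finite-dimensional. *)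
Definition dim (R : realType) (U : lmodType R) (S : set U) : nat :=
  xget 0%N [set n | exists b : 'I_n -> U, is_basis S b].

Definition potential (R : realType) (d : nat) (gamma : 'I_d -> R) :
    'rV[R]_d -> R^o :=
  fun x => \sum_(i < d) gamma i * x 0 i ^+ 2.

(* Normalized solutions p = (lambda, u) in X of the discrete Gross-Pitaevskii
   eigenvalue problem. *)
Definition gp_eigenpair (R : realType) (d : nat) (Om : set 'rV[R]_d)
    (gamma : 'I_d -> R) (zeta : R) (X : set (R^o * ('rV[R]_d -> R^o)))
    (p : R^o * ('rV[R]_d -> R^o)) : Prop :=
  let W := potential gamma in
  let: (lam, u) := p in
  [/\ X p,
      integral_on Om (fun x => u x ^+ 2) = 1 &
      forall q, X q -> let v := q.2 in
        integral_on Om (fun x =>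
          grad_dot u v x + W x * u x * v x + zeta * u x ^+ 3 * v x) =
        lam * integral_on Om (fun x => u x * v x)].

Definition gp_smallest_eigenpair (R : realType) (d : nat) (Om : set 'rV[R]_d)
    (gamma : 'I_d -> R) (zeta : R) (X : set (R^o * ('rV[R]_d -> R^o)))
    (p : R^o * ('rV[R]_d -> R^o)) : Prop :=
  gp_eigenpair Om gamma zeta X p /\
  forall q, gp_eigenpair Om gamma zeta X q -> (p.1 : R) <= q.1.

(* phat = (lambda^, u^) in X solves the linear problem posed by the previous
   iterate p. *)
Definition linear_bvp (R : realType) (d : nat) (Om : set 'rV[R]_d)
    (gamma : 'I_d -> R) (zeta : R) (X : set (R^o * ('rV[R]_d -> R^o)))
    (p phat : R^o * ('rV[R]_d -> R^o)) : Prop :=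
  let W := potential gamma in
  let: (lam, u) := p in
  let: (lamh, uh) := phat in
  X phat /\
  forall q, X q -> let: (mu, v) := q in
    integral_on Om (fun x =>
        grad_dot uh v x + W x * uh x * v x
        + 3 * zeta * u x ^+ 2 * uh x * v x - lam * uh x * v x)
      - lamh * integral_on Om (fun x => u x * v x)
    = integral_on Om (fun x => (2 * zeta * u x ^+ 3 - lam * u x) * v x)
    /\
    - mu * integral_on Om (fun x => uh x * u x)
    = - mu / 2 - mu / 2 * integral_on Om (fun x => u x ^+ 2).

Definition pair_dist (R : realType) (d : nat) (Om : set 'rV[R]_d)
    (p q : R^o * ('rV[R]_d -> R^o)) : R :=
  let w := p.2 \- q.2 in
  `|p.1 - q.1| + Num.sqrt (integral_on Om (fun x => w x ^+ 2 + grad_dot w w x)).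

(* The data of one execution of the multigrid method. Levels are numbered
   1, ..., mg_levels; values at other indices are irrelevant. The iterate at
   level k is (lambda^{h_k}, u^{h_k}); mg_tol k is the accuracy, on which nothing
   is assumed, with which the linear problem at level k is solved (0 for an
   exact solve); mg_eig_work is the work of the
   eigenvalue problem at level 1, and mg_bvp_work k that of the linear boundary
   value problem at level k. *)
Record multigrid_run (R : realType) (d : nat) := MultigridRun {
  mg_levels : nat;
  mg_mesh : nat -> seq (simplex R d);
  mg_iter : nat -> R^o * ('rV[R]_d -> R^o);
  mg_tol : nat -> R;
  mg_eig_work : R;
  mg_bvp_work : nat -> R
}.

Definition mg_space (R : realType) (d : nat) (Om : set 'rV[R]_d)
    (r : multigrid_run R d) (k : nat) : set (R^o * ('rV[R]_d -> R^o)) :=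
  fe_pair_space Om (mg_mesh r k).

(* N_k = dim X_{h_k} *)
Definition mg_dim (R : realType) (d : nat) (Om : set 'rV[R]_d)
    (r : multigrid_run R d) (k : nat) : nat :=
  dim (mg_space Om r k).

Definition multigrid_algorithm (R : realType) (d : nat) (Om : set 'rV[R]_d)
    (beta : nat) (gamma : 'I_d -> R) (zeta : R) (r : multigrid_run R d) :
    Prop :=
  let n := mg_levels r in
  let X := mg_space Om r in
  [/\ (1 <= n)%N,
      forall k, (1 <= k <= n)%N ->
        is_mesh Om (mg_mesh r k) /\ 0 <= mg_bvp_work r k,
      forall k, (1 <= k < n)%N ->
        regular_refinement beta (mg_mesh r k) (mg_mesh r k.+1) /\
        X k `<=` X k.+1,
      gp_smallest_eigenpair Om gamma zeta (X 1%N) (mg_iter r 1%N) /\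
        0 <= mg_eig_work r &
      forall k, (1 <= k < n)%N ->
        X k.+1 (mg_iter r k.+1) /\
        exists2 phat, linear_bvp Om gamma zeta (X k.+1) (mg_iter r k) phat &
          pair_dist Om (mg_iter r k.+1) phat <= mg_tol r k.+1].

(* W_k *)
Definition level_work (R : realType) (d : nat) (r : multigrid_run R d)
    (k : nat) : R :=
  if k == 1%N then mg_eig_work r else mg_bvp_work r k.

Definition total_work (R : realType) (d : nat) (r : multigrid_run R d) : R :=
  \sum_(1 <= k < (mg_levels r).+1) level_work r k.

(* f = O(g) with a single constant for all the parameters j in P. *)
Definition uniformly_bigO (R : realType) (J : Type) (P : set J) (f g : J -> R) :
    Prop :=
  exists2 C : R, 0 < C & forall j, P j -> `|f j| <= C * `|g j|.

(* f ~ g: c f <= g <= C f, with constants uniform in the parameters j in P. *)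
Definition uniformly_approx (R : realType) (J : Type) (P : set J)
    (f g : J -> R) : Prop :=
  exists c C : R, [/\ 0 < c, 0 < C &
    forall j, P j -> c * f j <= g j <= C * f j].

(* Main.v *)
Require Import Defs.
From HB Require Import structures.
From mathcomp Require Import all_boot all_order all_algebra.
From mathcomp Require Import all_classical all_reals all_analysis.
Set Implicit Arguments.
Unset Strict Implicit.
Unset Printing Implicit Defensive.
Import Order.TTheory GRing.Theory Num.Theory.
Import numFieldNormedType.Exports.
Local Open Scope classical_set_scope.
Local Open Scope ring_scope.

(** The geometric growth of the dimensions makes the finest level dominate.
    With [q = beta ^ d >= 2] the dimensions satisfy, up to a uniform constant,
    [N_k <= q ^ (k - n) N_n], and the sum of [q ^ (k - n)] over [k <= n] is
    bounded by [q] whatever the number [n] of levels ([sum_exprz_levels]).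
    Linear work on each level therefore adds up to [O(N_n)] uniformly in [n]
    ([sum_work_geometric]), without the factor [n] that bounding every level by
    the finest one would cost. The eigenvalue problem is solved only once, on
    the coarsest level, and contributes [O(M)]. *)

(** Since [q >= 2], each term is at most the next one minus itself, so the sum is
    dominated by a telescoping one, with value [q ^ 1 - q ^ (m - n)]. *)
Lemma sum_exprz_levels (R : realFieldType) (q : R) (m n : nat) :
  2 <= q -> (m <= n.+1)%N ->
  \sum_(m <= k < n.+1) q ^ (k%:Z - n%:Z) <= q.
Proof.
move=> q_ge2 le_mn; have q_gt0 : 0 < q by apply: lt_le_trans q_ge2.
pose f k := q ^ (k%:Z - n%:Z).
have f_gt0 k : 0 < f k by exact: exprz_gt0.
have fS k : f k.+1 = q * f k.
  by rewrite /f intS -addrA [LHS]exprzDr ?unitfE ?gt_eqF// expr1z.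
have f_last : f n.+1 = q by rewrite fS /f subrr expr0z mulr1.
apply: (@le_trans _ _ (\sum_(m <= k < n.+1) (f k.+1 - f k))).
  apply: ler_sum => k _; rewrite -/(f k) fS lerBrDr -mulr2n -mulr_natl.
  by rewrite ler_pM2r.
by rewrite telescope_sumr// f_last lerBlDr lerDl ltW.
Qed.

Lemma sum_work_geometric (R : realFieldType) (q c C : R) (m n : nat)
    (N : nat -> R) (w : nat -> R) :
  2 <= q -> 0 < c -> 0 <= C -> 0 <= N n -> (m <= n.+1)%N ->
  (forall k, (m <= k <= n)%N -> c * N k <= q ^ (k%:Z - n%:Z) * N n) ->
  (forall k, (m <= k <= n)%N -> `|w k| <= C * N k) ->
  `|\sum_(m <= k < n.+1) w k| <= C / c * q * N n.
Proof.
move=> q_ge2 c_gt0 C_ge0 Nn_ge0 le_mn N_growth w_bound.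
apply: (le_trans (ler_norm_sum _ _ _)).
apply: (@le_trans _ _
    (\sum_(m <= k < n.+1) C / c * N n * q ^ (k%:Z - n%:Z))).
  apply: ler_sum_nat => k; rewrite ltnS => k_level.
  apply: (le_trans (w_bound k k_level)).
  rewrite -!mulrA ler_wpM2l// ler_pdivlMl// [N n * _]mulrC.
  exact: N_growth.
rewrite -mulr_sumr [leRHS]mulrAC ler_wpM2l ?sum_exprz_levels//.
by rewrite mulr_ge0// divr_ge0// ltW.
Qed.

Theorem theorem5p1 (R : realType) (d : nat) (Om : set 'rV[R]_d) (beta : nat)
    (gamma : 'I_d -> R) (zeta : R)
    (I : Type) (run : I -> multigrid_run R d) (M : I -> R)
    (d_range : (1 <= d <= 3)%N)
    (Om_domain : bounded_domain Om)
    (beta_ge2 : (2 <= beta)%N)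
    (gamma_gt0 : forall i, 0 < gamma i)
    (zeta_gt0 : 0 < zeta)
    (run_multigrid : forall i, multigrid_algorithm Om beta gamma zeta (run i))
    (dim_growth : uniformly_approx
       [set p : I * nat | (1 <= p.2 <= mg_levels (run p.1))%N]
       (fun p => (mg_dim Om (run p.1) p.2)%:R : R)
       (fun p => let n := mg_levels (run p.1) in
          (beta%:R : R) ^ (d%:Z * (p.2%:Z - n%:Z))
          * (mg_dim Om (run p.1) n)%:R))
    (M_ge0 : forall i, 0 <= M i)
    (eig_work_bound : uniformly_bigO [set: I]
       (fun i => mg_eig_work (run i)) M)
    (bvp_work_bound : uniformly_bigO
       [set p : I * nat | (1 <= p.2 <= mg_levels (run p.1))%N]
       (fun p => mg_bvp_work (run p.1) p.2)
       (fun p => (mg_dim Om (run p.1) p.2)%:R)) :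
  let Nn := fun i : I => (mg_dim Om (run i) (mg_levels (run i)))%:R : R in
  uniformly_bigO [set: I]
    (fun i => total_work (run i)) (fun i => Nn i + M i) /\
  uniformly_bigO [set i | M i <= Nn i]
    (fun i => total_work (run i)) Nn.
Proof.
move=> Nn.
have q_ge2 : 2 <= (beta%:R : R) ^ d%:Z.
  rewrite -exprnP -natrX ler_nat (leq_trans beta_ge2)//.
  by rewrite -{1}(expn1 beta) leq_pexp2l ?(ltnW beta_ge2)//; case/andP: d_range.
have [c [C0 [c_gt0 _ N_growth]]] := dim_growth.
have [C1 C1_gt0 eig_bound] := eig_work_bound.
have [C2 C2_gt0 bvp_bound] := bvp_work_bound.
have Nn_ge0 i : 0 <= Nn i by exact: ler0n.
set q : R := beta%:R ^ d%:Z in q_ge2.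
have D_gt0 : 0 < C2 / c * q.
  by rewrite mulr_gt0 ?divr_gt0// (lt_le_trans _ q_ge2).
have work_bound i : `|total_work (run i)| <= (C1 + C2 / c * q) * (Nn i + M i).
  have [n_gt0 _ _ _ _] := run_multigrid i.
  rewrite /total_work big_ltn// {1}/level_work eqxx.
  have eig_i : `|mg_eig_work (run i)| <= C1 * M i.
    by have := eig_bound i Logic.I; rewrite [`|M i|]ger0_norm.
  have bvp_i : `|\sum_(2 <= k < (mg_levels (run i)).+1) level_work (run i) k|
      <= C2 / c * q * Nn i.
    apply: (@sum_work_geometric _ q c C2 2 (mg_levels (run i))
              (fun k => (mg_dim Om (run i) k)%:R)) => //; first exact: ltW.
      move=> k /andP[k_ge2 k_le].
      have /(_ _)/andP[|+ _] := N_growth (i, k); first by rewrite /= k_le ltnW.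
      by rewrite /q exprz_exp.
    move=> k /andP[k_ge2 k_le]; rewrite /level_work gtn_eqF//.
    have := bvp_bound (i, k); rewrite /= k_le ltnW// normr_nat.
    exact.
  apply: (le_trans (ler_normD _ _)); apply: (le_trans (lerD eig_i bvp_i)).
  rewrite mulrDl; apply: lerD.
    by rewrite ler_pM2l// lerDr.
  by rewrite ler_pM2l// lerDl.
have C_gt0 : 0 < C1 + C2 / c * q by exact: addr_gt0.
set C := C1 + C2 / c * q in work_bound C_gt0.
split.
  exists C => // i _.
  by rewrite [`|Nn i + M i|]ger0_norm ?addr_ge0.
exists (C * 2); first exact: mulr_gt0.
move=> i /= M_le_Nn; apply: (le_trans (work_bound i)).
rewrite [`|Nn i|]ger0_norm// -mulrA ler_pM2l// mulr_natl mulr2n.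
by rewrite lerD2l.
Qed.
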